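(* Let $\psi$ be a quasiperiodic flow on $T^2$ (generated by a constant vector field). Then the following are equivalent: (a) $\psi$ is transcendental; (b) $M_\psi=\{1,-1\}$; (c) $S_\psi\cong T^2\rtimes_\Gamma\mathbb{Z}_2$.
   Context: $T^2=\mathbb{R}^2/\mathbb{Z}^2$ is the $2$-torus with global coordinates $(\theta_1,\theta_2)$. For a smooth ($C^\infty$) flow $\psi:\mathbb{R}\times T^2\to T^2$, its generating vector field is $X_\psi(p)=\frac{d}{dt}\psi(t,p)|_{t=0}$. A constant vector field is one of the form $a_1\,\partial/\partial\theta_1+a_2\,\partial/\partial\theta_2$ with $a_1,a_2\in\mathbb{R}$. A flow generated by a constant vector field is quasiperiodic if the components $a_1,a_2$ are linearly independent over $\mathbb{Q}$. Generalized symmetry group: $S_\psi$ is the group of all $R\in\mathrm{Diff}(T^2)$ (smooth diffeomorphisms) for which there is $\alpha\in\mathbb{R}^*=\mathbb{R}\setminus\{0\}$ with $R_*X_\psi=\alpha X_\psi$, where $R_*X_\psi=\mathbf{T}R\,X_\psi\,R^{-1}$ is the push-forward and $\mathbf{T}R$ is the derivative map of $R$. The unique such $\alpha$ is the multiplier $\rho_\psi(R)$; this defines a homomorphism $\rho_\psi:S_\psi\to\mathbb{R}^*$, and the multiplier group is $M_\psi=\rho_\psi(S_\psi)\subset\mathbb{R}^*$. A real quadratic number field is a subfield $F$ of $\mathbb{R}$ of degree $2$ over $\mathbb{Q}$. A quasiperiodic flow $\psi$ on $T^2$ generated by $X_\psi=a_1\,\partial/\partial\theta_1+a_2\,\partial/\partial\theta_2$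 is called $F$-algebraic if there is $\vartheta\in\mathbb{R}^*$ such that $\{\vartheta a_1,\vartheta a_2\}$ is a $\mathbb{Q}$-basis of $F$. A quasiperiodic flow on $T^2$ is called transcendental if it is not $F$-algebraic for any real quadratic number field $F$. Notation: for a group $G$, ''$S_\psi\cong T^2\rtimes_\Gamma G$'' means that there is a subgroup $H_\psi$ of $S_\psi$ such that $S_\psi$ is the (internal) semidirect product of its normal subgroup $\rho_\psi^{-1}(\{1\})$ by $H_\psi$, with $\rho_\psi^{-1}(\{1\})\cong T^2$ and $H_\psi\cong G$ as groups; $\Gamma$ denotes the conjugation action $\Gamma(h)(g)=hgh^{-1}$ ($h\in H_\psi$, $g\in\rho_\psi^{-1}(\{1\})$), transported through these isomorphisms. $\mathbb{Z}_2$ is the group of order two. *)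

(* Defs.v *)
From HB Require Import structures.
From mathcomp Require Import all_boot all_order all_algebra.
From mathcomp Require Import all_classical all_reals all_analysis.
Import Order.TTheory GRing.Theory Num.Theory numFieldNormedType.Exports.
Set Implicit Arguments.
Unset Strict Implicit.
Unset Printing Implicit Defensive.

Local Open Scope classical_set_scope.
Local Open Scope ring_scope.

(* Diff(T^2) and its subgroups are encoded as subsets of the group, under
   composition, of all bijections of T^2. *)

Record bijections (T : Type) := Bijection {
  bij_fun :> T -> T;
  bij_inv : T -> T;
  bij_funK : cancel bij_fun bij_inv;
  bij_invK : cancel bij_inv bij_fun }.

Section BijectionGroup.
Variable T : Type.
Implicit Types f g h : bijections T.

HB.instance Definition _ := gen_eqMixin (bijections T).
HB.instance Definition _ := gen_choiceMixin (bijections T).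

Lemma bijections_eq f g : f =1 g -> f = g.
Proof.
case: f g => [f f' fK f'K] [g g' gK g'K] /= /funext fg; subst g.
have e : f' = g' by apply/funext => x; rewrite -[LHS]gK f'K.
by subst g'; congr Bijection; exact: Prop_irrelevance.
Qed.

Definition bij_id : bijections T := @Bijection T id id (frefl _) (frefl _).

Definition bij_comp f g : bijections T :=
  Bijection (can_comp (bij_funK f) (bij_funK g))
            (can_comp (bij_invK g) (bij_invK f)).

Definition bij_sym f : bijections T := Bijection (bij_invK f) (bij_funK f).

Lemma bij_compA : associative bij_comp.
Proof. by move=> f g h; exact: bijections_eq. Qed.
Lemma bij_comp1f : left_id bij_id bij_comp.
Proof. by move=> f; exact: bijections_eq. Qed.
Lemma bij_compf1 : right_id bij_id bij_comp.
Proof. by move=> f; exact: bijections_eq. Qed.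
Lemma bij_compVf : left_inverse bij_id bij_sym bij_comp.
Proof. by move=> f; apply: bijections_eq => x; exact: bij_funK. Qed.
Lemma bij_compfV : right_inverse bij_id bij_sym bij_comp.
Proof. by move=> f; apply: bijections_eq => x; exact: bij_invK. Qed.

HB.instance Definition _ := isGroup.Build (bijections T)
  bij_compA bij_comp1f bij_compf1 bij_compVf bij_compfV.
End BijectionGroup.

Section SemidirectProduct.
Variable U : groupType.
Implicit Types S N H : set U.
Local Open Scope group_scope.

Definition subgroup H S := H `<=` S /\ group_closed [in H].

Definition isomorphic_to (K : groupType) H :=
  exists phi : {multiplicative K -> U}, set_bij [set: K] H phi.

(* These conditions make S = N * H a subgroup of U. *)
Definition internal_semidirect S N H :=
  [/\ subgroup N S, subgroup H S,
      (forall s n, S s -> N n -> N (s * n * s^-1)),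
      N `&` H = [set 1] & S = [set n * h | n in N & h in H]].
End SemidirectProduct.

Section Smooth.
Variable R : realType.

(* Directional derivatives in every direction stand for partial derivatives;
   this is the usual notion since only finite-dimensional [V] are used. *)
Fixpoint C_on (n : nat) (V W : normedModType R) (U : set V) (f : V -> W) :=
  if n is m.+1 then (forall x, U x -> differentiable f x) /\
                    (forall v, C_on m U (fun x => 'D_v f x))
  else forall x, U x -> {for x, continuous f}.

Definition Cinfty_near (V W : normedModType R) (x : V) (f : V -> W) :=
  exists U : set V, [/\ open U, U x & forall n, C_on n U f].
End Smooth.

Section Torus.
Variable R : realType.

Definition int_lattice : {pred 'rV[R]_2} :=
  fun x => [forall i, x 0 i \is a Num.int].

Lemma int_lattice_zmod_closed : zmod_closed int_lattice.
Proof.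
split=> [|x y /forallP xZ /forallP yZ]; apply/forallP => i; rewrite !mxE ?rpred0//.
exact: rpredB.
Qed.

HB.instance Definition _ :=
  GRing.isZmodClosed.Build 'rV[R]_2 int_lattice int_lattice_zmod_closed.

Definition torus := Quotient.quot int_lattice.
HB.instance Definition _ := GRing.Zmodule.on torus.
HB.instance Definition _ := ZmodQuotient.on torus.

Definition torus_pi (x : 'rV[R]_2) : torus := (\pi_torus x)%qT.
Definition torus_repr (p : torus) : 'rV[R]_2 := repr p.

(* The representative in [-1/2, 1/2[^2 of q - p.  On the open set of those q for
   which it lies in ]-1/2, 1/2[^2 it is a chart centred at p, and it differs from
   the global coordinates (theta_1, theta_2) by a constant. *)
Definition chart (p q : torus) : 'rV[R]_2 :=
  \row_i (let t := torus_repr (q - p) 0 i in t - (Num.floor (t + 2^-1))%:~R).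

(* Tangent spaces of the torus are identified with R^2 by the frame
   (d/dtheta_1, d/dtheta_2). *)
Definition torus_derive (V : normedModType R) (F : V -> torus) (x v : V) :
  'rV[R]_2 := 'D_v (chart (F x) \o F) x.

Definition torus_smooth (V : normedModType R) (F : V -> torus) :=
  forall x, Cinfty_near x (chart (F x) \o F).

Definition vector_field := torus -> 'rV[R]_2.

(* The quotient map is a local diffeomorphism, so smoothness and derivatives of
   a map out of the torus are read off after composition with it. *)
Definition tangent_map (f : torus -> torus) (p : torus) (v : 'rV[R]_2) :=
  torus_derive (f \o torus_pi) (torus_repr p) v.

Definition Diff : set (bijections torus) :=
  [set f : bijections torus |
     torus_smooth (f \o torus_pi) /\ torus_smooth (bij_inv f \o torus_pi)].

Definition pushforward (f : bijections torus) (X : vector_field) : vector_field :=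
  fun p => tangent_map f (bij_inv f p) (X (bij_inv f p)).

Definition smooth_flow (psi : R -> torus -> torus) :=
  [/\ torus_smooth (fun z : R * 'rV[R]_2 => psi z.1 (torus_pi z.2)),
      psi 0 =1 id & forall s t p, psi (s + t) p = psi s (psi t p)].

Definition generating_field (psi : R -> torus -> torus) : vector_field :=
  fun p => torus_derive (psi ^~ p) 0 1.

Section Symmetries.
Variable psi : R -> torus -> torus.

Definition scales_field (f : bijections torus) (alpha : R) :=
  alpha != 0 /\ forall p,
    pushforward f (generating_field psi) p = alpha *: generating_field psi p.

Definition symmetry_group : set (bijections torus) :=
  [set f | Diff f /\ exists alpha, scales_field f alpha].

Definition multiplier (f : bijections torus) : R := get (scales_field f).

Definition multiplier_group : set R := multiplier @` symmetry_group.

Definition multiplier_kernel : set (bijections torus) :=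
  symmetry_group `&` multiplier @^-1` [set 1].

(* S_psi is isomorphic to the semidirect product of T^2 by G for the conjugation
   action Gamma; being induced by the choice of H, Gamma is not a parameter. *)
Definition semidirect_of_torus_by (G : groupType) :=
  exists H : set (bijections torus),
    [/\ internal_semidirect symmetry_group multiplier_kernel H,
        isomorphic_to (Algebra.to_multiplicative torus) multiplier_kernel
      & isomorphic_to G H].
End Symmetries.

Definition Q_independent (n : nat) (b : 'I_n -> R) :=
  forall c : 'I_n -> rat, \sum_i ratr (c i) * b i = 0 -> forall i, c i = 0.

Definition Q_basis (n : nat) (b : 'I_n -> R) (F : set R) :=
  Q_independent b /\
  F = [set x | exists c : 'I_n -> rat, x = \sum_i ratr (c i) * b i].

Definition real_quadratic_field (F : set R) :=
  GRing.divring_closed [in F] /\ exists b : 'I_2 -> R, Q_basis b F.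

Definition quasiperiodic (psi : R -> torus -> torus) :=
  smooth_flow psi /\ exists a : 'rV[R]_2,
    (forall p, generating_field psi p = a) /\ Q_independent (a 0).

Definition F_algebraic (F : set R) (psi : R -> torus -> torus) :=
  quasiperiodic psi /\ exists (a : 'rV[R]_2) (theta : R),
    [/\ forall p, generating_field psi p = a, theta != 0
      & Q_basis (fun i => theta * a 0 i) F].

Definition transcendental (psi : R -> torus -> torus) :=
  quasiperiodic psi /\ forall F, real_quadratic_field F -> ~ F_algebraic F psi.
End Torus.

(* Main.v *)
(* A diffeomorphism f with multiplier alpha maps orbits of the flow to orbits:
   t |-> f(p + t a) - t alpha a has derivative 0, so it is constant. The
   line R a is dense in T^2, so by continuity f - f(0) is a group
   endomorphism; being differentiable at 0 it is induced by an integer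
   matrix B, and B a = alpha a. If alpha is an integer then B is scalar and
   alpha = 1 or -1; otherwise a_2 / a_1 is a quadratic irrational and the
   flow is algebraic. Conversely, for an algebraic flow a nontrivial
   solution of Pell's equation gives a unimodular B with B a = alpha a and
   alpha irrational. If S were a semidirect product by Z_2, every multiplier
   would be that of an involution, hence of square 1. *)
Require Import Defs.
From HB Require Import structures.
From mathcomp Require Import all_boot all_order all_algebra.
From mathcomp Require Import all_classical all_reals all_analysis.
From mathcomp Require Import ring lra zify.
Set Implicit Arguments.
Unset Strict Implicit.
Unset Printing Implicit Defensive.
Import Order.TTheory GRing.Theory Num.Theory numFieldNormedType.Exports.
Local Open Scope classical_set_scope.
Local Open Scope ring_scope.

(** * Diophantine approximation and Pell's equation *)

(** Pigeonhole: the fractional parts of [y * b] for the [N + 1] values [0 <= y <= N] fall into [N]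
    intervals of length [1/N], and two in the same interval are subtracted. *)
Lemma dirichlet_approximation (R : realType) (b : R) (N : nat) : (0 < N)%N ->
  exists (x : int) (y : nat),
    (0 < y <= N)%N /\ `|y%:R * b - x%:~R| < N%:R^-1.
Proof.
move=> N0; have NR : 0 < N%:R :> R by rewrite ltr0n.
pose fr (y : nat) := y%:R * b - (Num.floor (y%:R * b))%:~R.
have fr01 y : 0 <= fr y < 1.
  have /andP[l u] := floor_itv (y%:R * b); rewrite /fr.
  by rewrite subr_ge0 l ltrBlDl (lt_le_trans u)// intrD lexx.
have bin y : (Num.trunc (N%:R * fr y) < N)%N.
  have /andP[l u] := fr01 y.
  rewrite -(ltr_nat R); apply: le_lt_trans (_ : N%:R * fr y < _).
    by have := @truncn_le R (N%:R * fr y); rewrite truncn_le mulr_ge0// ltW.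
  by rewrite gtr_pMr.
have [f_inj|] := boolP (injectiveb (fun y : 'I_N.+1 => Ordinal (bin y))).
  by have /leq_card := injectiveP _ f_inj; rewrite !card_ord ltnn.
move=> /injectivePn[i [j ij [eij]]].
wlog lij : i j ij eij / (i < j)%N.
  move=> H; case: (ltngtP i j) => [lt|gt|/val_inj eq]; first exact: H lt.
  - by apply: (H j i) gt; rewrite // eq_sym.
  - by rewrite eq eqxx in ij.
exists (Num.floor (j%:R * b) - Num.floor (i%:R * b)), (j - i)%N; split.
  by rewrite subn_gt0 lij /= (leq_trans (leq_subr _ _))// -ltnS.
have -> : (j - i)%:R * b - (Num.floor (j%:R * b) - Num.floor (i%:R * b))%:~R
   = fr j - fr i by rewrite natrB 1?ltnW// intrB /fr; ring.
have NV : 0 < N%:R^-1 :> R by rewrite invr_gt0.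
have tr y : (Num.trunc (N%:R * fr y))%:R <= N%:R * fr y < (Num.trunc (N%:R * fr y))%:R + 1.
  have /andP[l _] := fr01 y.
  by rewrite natr1 truncn_itv// mulr_ge0// ltW.
have := tr i; have := tr j; rewrite eij.
move: (_%:R) => k /andP[j1 j2] /andP[i1 i2].
rewrite -(ltr_pM2l NR) divff ?gt_eqF// -[X in X * `|_|]gtr0_norm// -normrM ltr_norml.
apply/andP; split; lra.
Qed.

(** Dirichlet's bound with [N > 1/e]: the error is below [1/N < e], and [y <= N] bounds the product
    by 1. Irrationality of [d] keeps the error positive, so that it can serve as the next
    tolerance. *)
Lemma irrational_approximation (R : realType) (d : R) (e : R) :
  (forall x y : int, x%:~R = y%:~R * d -> y = 0) -> 0 < e ->
  exists x y : int, [/\ 0 < y, 0 < `|x%:~R - y%:~R * d| < e &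
                     y%:~R * `|x%:~R - y%:~R * d| <= 1].
Proof.
move=> d_irr e0; pose N := (Num.bound e^-1).
have eN : e^-1 < N%:R by apply: archi_boundP; rewrite invr_ge0 ltW.
have NR : 0 < N%:R :> R by apply: lt_trans eN; rewrite invr_gt0.
have N0 : (0 < N)%N by rewrite -(ltr_nat R).
have [x [y [/andP[y0 yN] xy]]] := dirichlet_approximation d N0.
exists x, y%:Z; rewrite distrC in xy; split => //.
  apply/andP; split.
    rewrite normr_gt0 subr_eq0; apply/eqP => /d_irr H.
    by move: y0; rewrite -ltz_nat H.
  by apply: lt_trans xy _; rewrite invf_plt ?posrE.
apply: (@le_trans _ _ (N%:R * N%:R^-1)); last by rewrite divff// gt_eqF.
by apply: ler_pM => //; [rewrite ler_nat|exact: ltW].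
Qed.

Lemma nat_pigeonhole (T : finType) (f : nat -> T) :
  exists i j, (i < j)%N /\ f i = f j.
Proof.
have /injectivePn[i [j ij eij]] : ~~ injectiveb (fun i : 'I_#|T|.+1 => f i).
  by apply/negP => /injectiveP /leq_card; rewrite card_ord ltnn.
case: (ltngtP i j) ij => [lt _|gt _|/val_inj ->]; last by rewrite eqxx.
- by exists i, j.
- by exists j, i.
Qed.

(* The quotient of two elements of the same norm [k] that agree modulo [k] is
   a unit. *)
Lemma pell_quotient (D k a1 b1 a2 b2 : int) : k != 0 ->
  a1 ^+ 2 - D * b1 ^+ 2 = k -> a2 ^+ 2 - D * b2 ^+ 2 = k ->
  (a1 = a2 %[mod k])%Z -> (b1 = b2 %[mod k])%Z ->
  0 < b1 -> 0 < b2 -> (a1, b1) <> (a2, b2) ->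
  exists x y : int, y != 0 /\ x ^+ 2 - D * y ^+ 2 = 1.
Proof.
move=> k0 ek ek' ea eb b1_gt0 b2_gt0 ne.
have [s es] : exists s, a1 = a2 + s * k.
  exists ((a1 %/ k)%Z - (a2 %/ k)%Z).
  by rewrite {1}(divz_eq a1 k) ea {2}(divz_eq a2 k); ring.
have [t et] : exists t, b1 = b2 + t * k.
  exists ((b1 %/ k)%Z - (b2 %/ k)%Z).
  by rewrite {1}(divz_eq b1 k) eb {2}(divz_eq b2 k); ring.
(* With [r] a square root of [D], these are the coordinates of [(a1 + b1 r)(a2 - b2 r) / k]; the
   congruences make the division by [k] exact. *)
exists (1 + s * a2 - D * t * b2), (a2 * t - s * b2).
(* The difference of the two norm equations, divided by [k]. *)
have E0 : 2 * (s * a2 - D * t * b2) + k * (s ^+ 2 - D * t ^+ 2) = 0.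
  apply: (mulfI k0); rewrite mulr0; apply: (addIr k); rewrite add0r -[RHS]ek.
  by rewrite es et -[X in _ + X]ek'; ring.
have eb' : b1 = (1 + s * a2 - D * t * b2) * b2 + (a2 * t - s * b2) * a2.
  by rewrite et -ek'; ring.
have ea' : a1 = (1 + s * a2 - D * t * b2) * a2 + D * (a2 * t - s * b2) * b2.
  by rewrite es -ek'; ring.
have XY : (1 + s * a2 - D * t * b2) ^+ 2 - D * (a2 * t - s * b2) ^+ 2 = 1.
  by rewrite -[RHS]addr0 -E0 -ek'; ring.
(* If [y = 0] then [x = 1] or [x = -1]: the former makes the two pairs equal, the latter gives
   [b1 = - b2] against positivity. *)
split => //; apply/eqP => Y0; move: XY ea' eb'; rewrite Y0 expr0n mulr0 subr0.
rewrite !mul0r !addr0 => /eqP; rewrite sqrf_eq1 => /orP[] /eqP ->.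
  by rewrite !mul1r => ea' eb'; case: ne; rewrite ea' eb'.
by rewrite !mulN1r => _ eb'; move: b1_gt0; rewrite eb' oppr_gt0 lt_gtF.
Qed.

(** Norms bounded by [K] leave finitely many triples made of the norm and the residues of both
    coordinates modulo it, so some triple repeats. *)
Lemma pell_pigeonhole (D : int) (K : nat) (u : nat -> int * int) :
  let norm p : int := p.1 ^+ 2 - D * p.2 ^+ 2 in
  (forall n, norm (u n) != 0) -> (forall n, `|norm (u n)| < K%:Z) ->
  exists i j, [/\ (i < j)%N, norm (u j) = norm (u i),
    ((u i).1 = (u j).1 %[mod norm (u i)])%Z &
    ((u i).2 = (u j).2 %[mod norm (u i)])%Z].
Proof.
move=> norm; move: norm => norm norm_neq0 normK.
have mod_lt n z : (`|(z %% norm (u n))%Z| < K)%N.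
  rewrite -ltz_nat abszE ger0_norm ?modz_ge0//.
  exact: lt_trans (ltz_mod _ (norm_neq0 n)) (normK n).
(* The shift by [K] makes the norm positive, so that its absolute value keeps the sign
   information. *)
have norm_lt n : (absz (norm (u n) + K%:Z)%R < 2 * K)%N.
  have := normK n; move: (norm (u n)) => k; lia.
have [i [j [ij]]] := nat_pigeonhole
  (fun n => (Ordinal (norm_lt n), Ordinal (mod_lt n (u n).1),
             Ordinal (mod_lt n (u n).2))).
move=> [enorm e1 e2].
have nij : norm (u j) = norm (u i).
  have pos n : 0 <= norm (u n) + K%:Z.
    by have /ltW := normK n; rewrite ler_norml lerNl -subr_ge0 opprK addrC => /andP[].
  by move/(congr1 Posz): enorm; rewrite !abszE !ger0_norm// => /addIr.
have eq_mod (a b : int) : 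
    absz (a %% norm (u i))%Z = absz (b %% norm (u i))%Z -> (a = b %[mod norm (u i)])%Z.
  by move=> /(congr1 Posz); rewrite !abszE !ger0_norm ?modz_ge0.
exists i, j; split => //; apply: eq_mod.
- by rewrite -[X in _ = absz (_ %% X)%Z]nij.
- by rewrite -[X in _ = absz (_ %% X)%Z]nij.
Qed.

(** Good approximations [x/y] of [d] have norms [x^2 - D y^2] bounded by [1 + 2|d|]. An infinite
    sequence of distinct ones contains two with equal norm and residues, and their quotient is a
    unit. *)
Lemma pell (R : realType) (D : int) (d : R) :
  d ^+ 2 = D%:~R -> (forall x y : int, x%:~R = y%:~R * d -> y = 0) ->
  exists x y : int, y != 0 /\ x ^+ 2 - D * y ^+ 2 = 1.
Proof.
move=> dD d_irr.
have /choice[g gP] (e : R) : exists p : int * int, 0 < e ->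
    [/\ 0 < p.2, 0 < `|p.1%:~R - p.2%:~R * d| < e &
        p.2%:~R * `|p.1%:~R - p.2%:~R * d| <= 1].
  (* The pair [(0, 0)] is a default for nonpositive tolerances. *)
  have [e0|e0] := ltP 0 e; last by exists (0, 0).
  by have [x [y H]] := irrational_approximation d_irr e0; exists (x, y).
pose nm (p : int * int) : R := `|p.1%:~R - p.2%:~R * d|.
(* Each term must beat the error of its predecessor, so the errors decrease strictly and the pairs
   are distinct. *)
pose u n := iter n (fun p => g (nm p)) (g 1).
have uP n : [/\ 0 < (u n).2, 0 < nm (u n), nm (u n) <= 1 & (u n).2%:~R * nm (u n) <= 1].
  elim: n => [|n [y0 nu0 nu1 _]]; first by have [? /andP[? /ltW ?] ?] := gP 1 ltr01.
  have [? /andP[? lt] ?] := gP _ nu0; split => //.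
  by apply: le_trans nu1; exact: ltW.
have ulast n : nm (u n.+1) < nm (u n).
  by have [_ nu0 _ _] := uP n; have [_ /andP[_ ?] _] := gP _ nu0.
have udec m n : (m < n)%N -> nm (u n) < nm (u m).
  elim: n => // n IH; rewrite ltnS leq_eqVlt => /predU1P[->//|/IH].
  exact: lt_trans.
pose no (p : int * int) : int := p.1 ^+ 2 - D * p.2 ^+ 2.
have noE p : (no p)%:~R = (p.1%:~R - p.2%:~R * d) * (p.1%:~R + p.2%:~R * d) :> R.
  by rewrite /no intrB rmorphXn intrM rmorphXn -dD /=; ring.
pose K := (Num.bound (1 + 2 * `|d|)).
have noK n : `|no (u n)| < K%:Z.
  have [y0 _ n1 yn] := uP n.
  (* The conjugate factor differs from [x - y d] by [2 y d]; multiplied by the error, which is at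
     most [1] and at most [1/y], this gives the bound [1 + 2|d|]. *)
  have nd : `|(u n).1%:~R + (u n).2%:~R * d| <= nm (u n) + 2 * (u n).2%:~R * `|d|.
    rewrite (_ : _ + _ = (u n).1%:~R - (u n).2%:~R * d + 2 * (u n).2%:~R * d); last by ring.
    by rewrite (le_trans (ler_normD _ _))// lerD2l !normrM normr_nat
         (gtr0_norm (_ : 0 < (u n).2%:~R)) ?ltr0z.
  rewrite -(ltr_int R); apply: le_lt_trans (_ : 1 + 2 * `|d| < _); last first.
    by apply: archi_boundP; rewrite addr_ge0// mulr_ge0.
  rewrite intr_norm noE normrM -/(nm (u n)).
  have n0 : 0 <= nm (u n) by exact: normr_ge0.
  apply: le_trans (ler_wpM2l n0 nd) _; rewrite mulrDr lerD//.
    by rewrite mulr_ile1.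
  rewrite (_ : _ * _ = 2 * ((u n).2%:~R * nm (u n)) * `|d|); last by ring.
  by rewrite ler_wpM2r// ler_piMr.
have no_neq0 n : no (u n) != 0.
  have [y0 nu0 _ _] := uP n.
  rewrite -(intr_eq0 R) noE mulf_neq0//; first by rewrite -normr_gt0.
  apply/eqP => H; move: y0.
  have /d_irr : (- (u n).1)%:~R = (u n).2%:~R * d by rewrite intrN; lra.
  by move=> ->; rewrite ltxx.
have [i [j [ij nij eij1 eij2]]] := pell_pigeonhole no_neq0 noK.
have [y1 _ _ _] := uP i; have [y2 _ _ _] := uP j.
apply: (pell_quotient (no_neq0 i) erefl nij) => // eij.
by have := udec _ _ ij; rewrite [u i]surjective_pairing eij -surjective_pairing ltxx.
Qed.

(** * The flat torus *)

Section RowNorm.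
Variable R : realType.

Lemma coord_le_norm n (x : 'rV[R]_n) i : `|x 0 i| <= `|x|.
Proof. by rewrite -[leRHS]/(mx_norm _) mx_normrE (le_bigmax _ _ (0, i)). Qed.

Lemma norm_rV_le n (x : 'rV[R]_n) e :
  0 <= e -> (forall i, `|x 0 i| <= e) -> `|x| <= e.
Proof.
move=> e0 xe; rewrite -[leLHS]/(mx_norm _) mx_normrE bigmax_le// => -[i j] _.
by rewrite ord1 xe.
Qed.

End RowNorm.

Section TorusNorm.
Variable R : realType.
Implicit Types (x y : 'rV[R]_2) (p q : torus R).

Lemma torus_pi0 : torus_pi 0 = 0 :> torus R.
Proof. by rewrite /torus_pi piE. Qed.

Lemma torus_piD : {morph @torus_pi R : x y / x + y}.
Proof. by move=> x y; rewrite /torus_pi !piE. Qed.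

Lemma torus_piN : {morph @torus_pi R : x / - x}.
Proof. by move=> x; rewrite /torus_pi !piE. Qed.

Lemma torus_piB : {morph @torus_pi R : x y / x - y}.
Proof. by move=> x y; rewrite torus_piD torus_piN. Qed.

Lemma torus_reprK : cancel (@torus_repr R) (@torus_pi R).
Proof. exact: reprK. Qed.

Lemma torus_pi_eq0 x : (torus_pi x == 0) = (x \in @int_lattice R).
Proof.
rewrite -torus_pi0 -[x in RHS]subr0 /torus_pi.
by rewrite (Quotient.idealrBE (@int_lattice R)).
Qed.

(** A section of the projection with values in [[-1/2, 1/2[^2]. *)
Definition torus_coord p : 'rV[R]_2 := chart 0 p.

Lemma chartE p q : chart p q = torus_coord (q - p).
Proof. by rewrite /torus_coord /chart subr0. Qed.

Lemma torus_coordK : cancel torus_coord (@torus_pi R).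
Proof.
move=> p; apply/eqP; rewrite -[p in eqbRHS]torus_reprK -subr_eq0 -torus_piB.
rewrite torus_pi_eq0; apply/forallP => i; rewrite !mxE subr0 addrAC subrr add0r.
by rewrite rpredN intr_int.
Qed.

Lemma torus_coord_lt_half x : `|x| < 2^-1 -> torus_coord (torus_pi x) = x.
Proof.
move=> x_lt; apply/rowP => i; rewrite !mxE subr0 /=.
set t := torus_repr _ 0 i.
have [k tk] : exists k : int, t = x 0 i + k%:~R.
  have : torus_repr (torus_pi x) - x \in @int_lattice R.
    by rewrite -torus_pi_eq0 torus_piB torus_reprK subrr.
  move=> /forallP /(_ i); rewrite !mxE => /intrP [k tk].
  by exists k; rewrite -tk addrCA subrr addr0.
have xi : `|x 0 i| < 2^-1 by apply: le_lt_trans x_lt; exact: coord_le_norm.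
have -> : Num.floor (t + 2^-1) = k.
  apply: floor_def; rewrite intrD tk; move: xi; rewrite ltr_norml => /andP[]; lra.
by rewrite tk addrK.
Qed.

(** The flat distance from [p] to 0 for the sup norm; by [torus_norm_pi] it is the least norm of a
    lift of [p]. *)
Definition torus_norm p : R := `|torus_coord p|.

Lemma torus_norm_pi x : torus_norm (torus_pi x) <= `|x|.
Proof.
have [x_lt|x_ge] := ltP `|x| 2^-1; first by rewrite /torus_norm torus_coord_lt_half.
apply: le_trans x_ge; apply: norm_rV_le => // i; rewrite !mxE subr0 /=.
set t := torus_repr _ 0 i; have := floor_itv (t + 2^-1); rewrite intrD => /andP[].
by rewrite ler_norml => ? ?; apply/andP; split; lra.
Qed.

Lemma torus_normN p : torus_norm (- p) <= torus_norm p.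
Proof.
rewrite {2}/torus_norm -[X in - X]torus_coordK -torus_piN.
by apply: le_trans (torus_norm_pi _) _; rewrite normrN.
Qed.

Lemma torus_normD p q : torus_norm (p + q) <= torus_norm p + torus_norm q.
Proof.
rewrite -[X in X + _]torus_coordK -[X in _ + X]torus_coordK -torus_piD.
apply: le_trans (torus_norm_pi _) _; exact: ler_normD.
Qed.

Lemma torus_norm_eq0 p : torus_norm p = 0 -> p = 0.
Proof.
by move=> /normr0_eq0 p0; rewrite -[p]torus_coordK p0 torus_pi0.
Qed.
End TorusNorm.

(** * Smooth maps along an irrational flow *)

Lemma ord2P (P : 'I_2 -> Prop) : P 0 -> P 1 -> forall i, P i.
Proof.
move=> P0 P1 [[|[|//]] i2]; first by rewrite (_ : Ordinal _ = 0)//; exact: val_inj.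
by rewrite (_ : Ordinal _ = 1)//; exact: val_inj.
Qed.

Lemma sum_ord2 (V : nmodType) (F : 'I_2 -> V) : \sum_i F i = F 0 + F 1.
Proof. by rewrite big_ord_recl big_ord1; congr (_ + F _); exact: val_inj. Qed.

Lemma Q_independent2 (R : realType) (b : 'I_2 -> R) : Q_independent b <->
  forall u v : rat, ratr u * b 0 + ratr v * b 1 = 0 -> u = 0 /\ v = 0.
Proof.
split=> [b_ind u v uv|b_ind c]; last by rewrite sum_ord2 => /b_ind [? ?]; apply: ord2P.
have c0 (i : 'I_2) : (if i == 0 then u else v) = 0.
  by apply: (b_ind (fun j => if j == 0 then u else v)); rewrite sum_ord2.
by split; [have := c0 0|have := c0 1].
Qed.

Lemma Q_independent2_int (R : realType) (b : 'I_2 -> R) (u v : int) :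
  Q_independent b -> u%:~R * b 0 + v%:~R * b 1 = 0 -> u = 0 /\ v = 0.
Proof.
move=> /Q_independent2 b_ind uv.
have [|/eqP + /eqP] := b_ind u%:~R v%:~R; first by rewrite !ratr_int.
by rewrite !intr_eq0 => /eqP ? /eqP.
Qed.

Lemma Q_independent2_neq0 (R : realType) (b : 'I_2 -> R) :
  Q_independent b -> b 0 != 0.
Proof.
move=> b_ind; apply/eqP => b0.
have [|/eqP] := @Q_independent2_int _ b 1 0 b_ind; last by [].
by rewrite b0 mul0r mulr0 addr0.
Qed.

Section TorusDynamics.
Variable R : realType.
Implicit Types (x y a : 'rV[R]_2) (p q : torus R).

Lemma torus_norm_dist p q r :
  `|torus_norm (p - r) - torus_norm (q - r)| <= torus_norm (p - q).
Proof.
have tr p' q' : torus_norm (p' - r) - torus_norm (q' - r) <= torus_norm (p' - q').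
  by rewrite lerBlDr -{1}[p'](subrK q') -addrA torus_normD.
rewrite ler_norml lerNl opprB tr andbT (le_trans (tr _ _))//.
by rewrite -[q - p]opprB torus_normN.
Qed.

Lemma torus_normMn p n : torus_norm (p *+ n) <= torus_norm p *+ n.
Proof.
elim: n => [|n IH]; last by rewrite !mulrS (le_trans (torus_normD _ _))// lerD2l.
by rewrite !mulr0n -torus_pi0 (le_trans (torus_norm_pi _))// normr0.
Qed.

(* Distances to [g 0] along [g] form a real function of derivative 0. *)
Lemma torus_path_const (g : R -> torus R) :
  (forall t e, 0 < e ->
     \forall s \near (0 : R), torus_norm (g (t + s) - g t) <= e * `|s|) ->
  forall t, g t = g 0.
Proof.
move=> g_small t; apply/eqP; rewrite -subr_eq0; apply/eqP/torus_norm_eq0.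
pose u s := torus_norm (g s - g 0).
have u0 : u 0 = 0.
  rewrite /u subrr -torus_pi0; apply: le_anti.
  by rewrite normr_ge0 (le_trans (torus_norm_pi _))// normr0.
rewrite -/(u t) -u0; apply: is_derive_0_is_cst => s.
suff H : (fun h => h^-1 *: ((u \o shift s) (h *: (1 : R)) - u s)) @ 0^' --> (0 : R).
  by apply: DeriveDef; [apply: cvgP H|apply: cvg_lim H].
apply/cvgr0Pnorm_le => e e0; near=> h.
have h0 : h != 0 by near: h; exact: nbhs_dnbhs_neq.
rewrite normrZ normfV ler_pdivrMl ?normr_gt0// /= scaler1 (addrC h).
apply: le_trans (torus_norm_dist _ _ _) _; rewrite mulrC.
by near: h; apply: nbhs_dnbhs; exact: g_small.
Unshelve. all: by end_near. Qed.

Lemma torus_smooth_differentiable (V : normedModType R) (F : V -> torus R) (x : V) :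
  torus_smooth F -> differentiable (chart (F x) \o F) x.
Proof. by move=> /(_ x) [U [_ Ux /(_ 1%N) [/(_ x Ux)]]]. Qed.

(** The Taylor expansion written with the group law instead of charts: projecting to the torus does
    not increase norms, so the remainder in the chart bounds the one on the torus. *)
Lemma torus_smooth_first_order (f : torus R -> torus R) q :
  torus_smooth (f \o @torus_pi R) ->
  exists L : {linear 'rV[R]_2 -> 'rV[R]_2},
    (L = tangent_map f q :> (_ -> _)) /\ 
    forall e, 0 < e -> \forall x \near (0 : 'rV[R]_2),
      torus_norm (f (q + torus_pi x) - f q - torus_pi (L x)) <= e * `|x|.
Proof.
move=> f_smooth; set x0 := torus_repr q; set F := f \o @torus_pi R.
have dG := torus_smooth_differentiable x0 f_smooth.
set G := chart (F x0) \o F in dG.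
exists ('d G x0); split.
  by apply/funext => v; rewrite /tangent_map /torus_derive -/F -/x0 -/G deriveE.
move=> e e0.
have G0 : G x0 = 0 by rewrite /G /= chartE subrr -torus_pi0 torus_coord_lt_half// normr0.
have /eqaddoP := diff_locally dG.
move=> /(_ e e0); apply: filterS => h /=.
rewrite [X in `|X|]/= G0 => Gh; apply: le_trans Gh.
rewrite (_ : _ - _ - _ = torus_pi (G (h + x0) - 'd G x0 h)).
  by apply: le_trans (torus_norm_pi _) _; rewrite add0r.
rewrite torus_piB /G /= chartE torus_coordK /F /= torus_piD torus_reprK.
by rewrite [q + _]addrC.
Qed.

Lemma torus_smooth_continuous (f : torus R -> torus R) q e :
  torus_smooth (f \o @torus_pi R) -> 0 < e ->
  \forall x \near (0 : 'rV[R]_2), torus_norm (f (q + torus_pi x) - f q) <= e.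
Proof.
move=> f_smooth e0; set x0 := torus_repr q.
have := differentiable_continuous (torus_smooth_differentiable x0 f_smooth).
set G := chart _ \o _.
move=> /cvgrPdist_le /(_ e e0) /nbhs_normP [d d0 G_near].
apply/nbhs_norm0P; exists d => // x xd.
have := G_near (x0 + x); rewrite /ball_/= opprD addNKr normrN => /(_ xd).
rewrite /G /= !chartE subrr -torus_pi0 torus_coord_lt_half ?normr0//.
by rewrite sub0r normrN torus_piD torus_reprK.
Qed.

Section Symmetry.
Variables (psi : R -> torus R -> torus R) (a : 'rV[R]_2).
Hypothesis psi_a : forall p, generating_field psi p = a.

Lemma scales_fieldE f alpha p :
  scales_field psi f alpha -> tangent_map f p a = alpha *: a.
Proof.
by move=> [_ /(_ (f p))]; rewrite /Defs.pushforward bij_funK !psi_a.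
Qed.

(** At every point the derivative of [f] sends [a] to [alpha *: a], so the first-order terms in the
    increments of [g] cancel. *)
Lemma symmetry_flow f alpha q t : Diff f -> scales_field psi f alpha ->
  f (q + torus_pi (t *: a)) = f q + torus_pi ((t * alpha) *: a).
Proof.
move=> [f_smooth _] f_alpha.
pose g s := f (q + torus_pi (s *: a)) - torus_pi ((s * alpha) *: a).
suff : g t = g 0.
  by rewrite /g mul0r scale0r torus_pi0 subr0 addr0 => /eqP; rewrite subr_eq => /eqP.
apply: torus_path_const => {}t e e0; rewrite /g.
set q' := q + torus_pi (t *: a).
have [L [Lf f_near]] := torus_smooth_first_order q' f_smooth.
(* This tolerance absorbs the factor [|a|] of [|s *: a|]; the summand 1 keeps the denominator
   positive. *)
have eM : 0 < e / (1 + `|a|) by rewrite divr_gt0// ltr_pwDl.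
have sa_cvg : (s *: a) @[s --> (0 : R)] --> (0 : 'rV[R]_2).
  by rewrite -[X in _ --> X](scale0r a); apply: cvgZr_tmp; exact: cvg_id.
near=> s.
rewrite scalerDl torus_piD addrA -/q' mulrDl scalerDl torus_piD.
rewrite (_ : _ - _ = f (q' + torus_pi (s *: a)) - f q' - torus_pi (L (s *: a))).
  have : torus_norm (f (q' + torus_pi (s *: a)) - f q' - torus_pi (L (s *: a)))
     <= e / (1 + `|a|) * `|s *: a|.
    by near: s; exact: (sa_cvg _ (f_near _ eM)).
  move=> /le_trans; apply; rewrite normrZ mulrCA [leRHS]mulrC.
  rewrite ler_wpM2l// mulrAC ler_pdivrMr ?ltr_pwDl//.
  by rewrite ler_wpM2l ?lerDr// ltW.
rewrite linearZ Lf/= (scales_fieldE _ f_alpha) scalerA.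
by rewrite opprB opprD -addrA [X in _ + X]addrACA addNr add0r [- _ - _]addrC addrA.
Unshelve. all: by end_near. Qed.

End Symmetry.

(** The times at which the line has the first coordinate of [p] modulo 1 suffice. Among them, steps
    of [Y / a0] move the second coordinate, modulo 1, by the small amount [eta] up to sign. *)
Lemma irrational_line_dense a p e : Q_independent (a 0) -> 0 < e ->
  exists t, torus_norm (p - torus_pi (t *: a)) < e.
Proof.
move=> a_ind e0; set a0 := a 0 0; set a1 := a 0 1; set y := torus_repr p.
have a0_neq0 : a0 != 0 := Q_independent2_neq0 a_ind.
have [|X [Y [_ /andP[eta_gt0 eta_lt] _]]] := @irrational_approximation _ (a1 / a0) e _ e0.
  move=> u v uv; have [|] := @Q_independent2_int _ _ u (- v) a_ind => [|_ /eqP].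
    by rewrite uv -/a0 -/a1 mulrA divfK// intrN mulNr subrr.
  by rewrite oppr_eq0 => /eqP.
set eta := _ - _ in eta_gt0 eta_lt.
(* [c] is the gap in the second coordinate at time [y_0 / a0]; removing [k] multiples of [eta]
   leaves less than [|eta|]. *)
pose c := y 0 1 - y 0 0 * (a1 / a0); pose k := Num.floor (c / eta).
have eta_neq0 : eta != 0 by rewrite -normr_gt0.
have ck : `|c - k%:~R * eta| < e.
  have /andP[k1 k2] := floor_itv (c / eta); rewrite -/k intrD in k1 k2.
  rewrite (_ : _ - _ = (c / eta - k%:~R) * eta); last by rewrite mulrBl divfK.
  rewrite normrM; apply: le_lt_trans eta_lt; rewrite ler_piMl//.
  by rewrite ger0_norm; lra.
exists ((y 0 0 - (k * Y)%:~R) / a0).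
pose r : 'rV[R]_2 := \row_i (if i == 0 then 0 else c - k%:~R * eta).
suff -> : p - torus_pi ((y 0 0 - (k * Y)%:~R) / a0 *: a) = torus_pi r.
  apply: le_lt_trans (torus_norm_pi _) (le_lt_trans (norm_rV_le _ _) ck) => //.
  by apply: ord2P; rewrite mxE/= ?normr0.
rewrite -[p]torus_reprK -torus_piB -/y; apply/eqP; rewrite -subr_eq0 -torus_piB torus_pi_eq0.
apply/forallP; apply: ord2P; rewrite !mxE/= -/a0 -/a1.
  by rewrite divfK// subr0 opprB addrC subrK intr_int.
rewrite (_ : _ - _ - _ = (k * X)%:~R) ?intr_int// !intrM /eta /c; field.
exact: a0_neq0.
Qed.
End TorusDynamics.

(** * Symmetries as integral affine maps *)

Section AffineSymmetry.
Variables (R : realType) (psi : R -> torus R -> torus R) (a : 'rV[R]_2).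
Hypothesis psi_a : forall p, generating_field psi p = a.
Hypothesis a_ind : Q_independent (a 0).
Implicit Types (x y : 'rV[R]_2) (p q : torus R) (f : bijections (torus R)).

Lemma torus_norm_small p : (forall e, 0 < e -> torus_norm p <= e) -> p = 0.
Proof.
move=> p_small; apply: torus_norm_eq0; apply: le_anti; rewrite normr_ge0 andbT.
by apply/ler_addgt0Pr => e /p_small; rewrite add0r.
Qed.

(** A nonzero vector rescaled to norm [1/4] lies where [torus_coord] inverts the projection, so it
    cannot project to 0. *)
Lemma torus_pi_line_inj x : (forall t : R, torus_pi (t *: x) = 0) -> x = 0.
Proof.
move=> x_line; apply/eqP/contraT => x_neq0.
have x_gt0 : 0 < `|x| by rewrite normr_gt0.
have lt_half : `|(4 * `|x|)^-1 *: x| < 2^-1.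
  rewrite normrZ gtr0_norm ?invr_gt0 ?mulr_gt0// invfM -mulrA mulVf ?gt_eqF//.
  by rewrite mulr1; lra.
have := torus_coord_lt_half lt_half.
rewrite x_line -torus_pi0 torus_coord_lt_half ?normr0// => /esym/eqP.
by rewrite scaler_eq0 (negPf x_neq0) orbF invr_eq0 mulf_eq0 !gt_eqF.
Qed.

(** For [q] on the orbit of 0 this is [symmetry_flow] applied at [p] and at 0. Density of the orbit
    and continuity of [f] at [p + q] and at [q] extend it to all [q]. *)
Lemma symmetry_translate f alpha p q : Diff f -> scales_field psi f alpha ->
  f (p + q) = f p + f q - f 0.
Proof.
move=> Df fa; apply/eqP; rewrite -subr_eq0; apply/eqP/torus_norm_small => e e0.
have e2 : 0 < e / 2 by rewrite divr_gt0.
have /nbhs_norm0P [d1 /= d10 near1] := torus_smooth_continuous (p + q) (proj1 Df) e2.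
have /nbhs_norm0P [d2 /= d20 near2] := torus_smooth_continuous q (proj1 Df) e2.
have [|t] := @irrational_line_dense R a q (Num.min d1 d2) a_ind.
  by rewrite lt_min d10.
set w := torus_coord (q - torus_pi (t *: a)).
rewrite /torus_norm -/w lt_min => /andP[w1 w2].
have q_w : q + torus_pi (- w) = 0 + torus_pi (t *: a).
  by rewrite torus_piN torus_coordK opprB add0r addrC subrK.
have := near1 (- w); have := near2 (- w); rewrite /= normrN => /(_ w2) + /(_ w1).
rewrite -addrA !q_w add0r -[X in f X - f q]add0r.
rewrite !(symmetry_flow psi_a _ _ Df fa) => n2 n1.
set v := torus_pi _ in n1 n2.
(* The flow moves [f 0] and [f p] by the same [v], which cancels and leaves two continuity errors of
   at most [e / 2]. *)
rewrite (_ : _ - _ = (f 0 + v - f q) - (f p + v - f (p + q))); last first.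
  rewrite [f 0 + v - _]addrAC [in RHS]opprB [in RHS]opprD [X in _ = _ + X]addrA.
  rewrite [RHS]addrACA subrr addr0 [RHS]addrACA opprB opprD.
  by rewrite !addrA [f 0 + _]addrC [LHS]addrAC.
by rewrite [e]splitr (le_trans (torus_normD _ _))// lerD// (le_trans (torus_normN _)).
Qed.

Lemma symmetry_translateMn f alpha p n : Diff f -> scales_field psi f alpha ->
  f (p *+ n) - f 0 = (f p - f 0) *+ n.
Proof.
move=> Df fa; elim: n => [|n IH]; first by rewrite !mulr0n subrr.
by rewrite !mulrS (symmetry_translate _ _ Df fa) -IH [RHS]addrACA addrA.
Qed.

(** By additivity the error of the linear approximation at [x] is [n] times the error at [x / n].
    The latter is at most [(e / |x|) (|x| / n)], so the former is at most [e] for every [e > 0]. *)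
Lemma symmetry_linear f alpha : Diff f -> scales_field psi f alpha ->
  exists L : {linear 'rV[R]_2 -> 'rV[R]_2},
    forall x, f (torus_pi x) = f 0 + torus_pi (L x).
Proof.
move=> Df fa.
have [L [_ L_near]] := torus_smooth_first_order 0 (proj1 Df).
exists L => x; apply/eqP; rewrite -subr_eq0; apply/eqP/torus_norm_small => e e0.
have [->|x_neq0] := eqVneq x 0.
  by rewrite linear0 !torus_pi0 addr0 subrr -torus_pi0
     (le_trans (torus_norm_pi _))// normr0 ltW.
have x_gt0 : 0 < `|x| by rewrite normr_gt0.
have /L_near : 0 < e / `|x| by rewrite divr_gt0.
move=> /nbhs_norm0P [d /= d0 near_d].
(* Large enough for [x / n] to lie in the ball of radius [d]; the successor makes [n] positive. *)
pose n := (Num.bound (`|x| / d)).+1.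
have n_gt : `|x| / d < n%:R.
  by apply: lt_trans (archi_boundP _) _; rewrite ?ltr_nat// divr_ge0// ltW.
pose y := n%:R^-1 *: x.
have yn : y *+ n = x by rewrite -scaler_nat scalerA divff ?scale1r// pnatr_eq0.
have ny : `|y| = n%:R^-1 * `|x| by rewrite normrZ ger0_norm.
have /near_d : `|y| < d by rewrite ny ltr_pdivrMl ?ltr0n// -ltr_pdivrMr.
rewrite add0r ny => H.
have -> : f (torus_pi x) - (f 0 + torus_pi (L x)) =
    (f (torus_pi y) - f 0 - torus_pi (L y)) *+ n.
  have piMn z : torus_pi (z *+ n) = torus_pi z *+ n.
    by elim: n {yn n_gt y ny H} => [|n IH]; rewrite ?torus_pi0// !mulrS torus_piD IH.
  rewrite opprD addrA -yn piMn (symmetry_translateMn _ _ Df fa) !mulrnBl.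
  by rewrite linearMn piMn.
apply: le_trans (torus_normMn _ _) _.
rewrite -mulr_natr -ler_pdivlMr ?ltr0n//.
by apply: le_trans H _; rewrite mulrCA divfK ?gt_eqF// mulrC.
Qed.

Lemma symmetry_affine f alpha : Diff f -> scales_field psi f alpha ->
  exists B : 'M[int]_2, [/\ a *m map_mx intr B = alpha *: a &
    forall x, f (torus_pi x) = f 0 + torus_pi (x *m map_mx intr B)].
Proof.
move=> Df fa; have [L fL] := symmetry_linear Df fa.
(* Unit vectors project to 0, where [f] has the value [f 0]; hence [L] maps them into the
   lattice. *)
have Lint i j : L (delta_mx 0 i) 0 j \is a Num.int.
  have : torus_pi (L (delta_mx 0 i)) == 0.
    rewrite -(inj_eq (addrI (f 0))) -fL addr0.
    suff -> : torus_pi (delta_mx 0 i : 'rV[R]_2) = 0 by [].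
    apply/eqP; rewrite torus_pi_eq0; apply/forallP => k.
    by rewrite !mxE; case: (_ && _); rewrite ?rpred0 ?rpred1.
  by rewrite torus_pi_eq0 => /forallP.
pose B : 'M[int]_2 := \matrix_(i, j) Num.floor (L (delta_mx 0 i) 0 j).
have LB x : L x = x *m map_mx intr B.
  rewrite -(mul_rV_lin1 L); congr (_ *m _); apply/matrixP => i j.
  by rewrite !mxE floorK.
exists B; split; last by move=> x; rewrite fL LB.
(* Both [t *: L a] and [(t * alpha) *: a] describe the image of the orbit of 0, so their difference
   projects to 0 for all [t]. *)
apply/eqP; rewrite -subr_eq0; apply/eqP/torus_pi_line_inj => t.
rewrite scalerBr torus_piB -LB -linearZ /= scalerA.
apply: (addrI (f 0)); rewrite addrA -fL addr0 -[X in f X]add0r.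
by rewrite (symmetry_flow psi_a _ _ Df fa) addrK.
Qed.

End AffineSymmetry.

(** * Affine maps of the torus *)

Section LocalSmoothness.
Variable R : realType.

Lemma near_eq_differentiable (V W : normedModType R) (f g : V -> W) x :
  {near x, f =1 g} -> differentiable f x -> differentiable g x.
Proof.
move=> fg df; have dfc : continuous ('d f x) by exact: diff_continuous.
have fgx : f x = g x := nbhs_singleton fg.
have dg : g \o shift x = cst (g x) + 'd f x +o_ 0 id.
  apply/eqaddoP => e e0; have /eqaddoP /(_ e e0) := diff_locally df.
  have : \forall h \near (0 : V), f (h + x) = g (h + x).
    have : \forall y \near x, f y = g y by [].
    rewrite (near_shift 0 x) => fg0.
    by apply: filterS fg0 => h /=; rewrite subr0.
  by apply: filterS2 => h /= fgh; rewrite -fgx !fctE /= fgh.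
apply/diff_locallyP; have -> : 'd g x = 'd f x :> (V -> W) by exact: diff_unique.
by split.
Qed.

(** On an open set, maps that agree have directional derivatives that agree, which drives the
    induction. It transfers smoothness from an affine map to a chart expression equal to it only
    locally. *)
Lemma eq_on_C_on n (V W : normedModType R) (U : set V) (f g : V -> W) :
  open U -> (forall x, U x -> f x = g x) -> C_on n U f -> C_on n U g.
Proof.
move=> Uopen; elim: n f g => [|n IH] f g fg.
  move=> fc x Ux; rewrite /prop_for/continuous_at -(fg x Ux).
  apply: cvg_trans (fc x Ux); apply: near_eq_cvg.
  by apply: filterS (open_nbhs_nbhs (conj Uopen Ux)) => y /fg.
have fg_near x : U x -> {near x, f =1 g}.
  by move=> Ux; apply: filterS (open_nbhs_nbhs (conj Uopen Ux)) => y /fg.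
move=> [df dfC]; split=> [x Ux|v].
  exact: near_eq_differentiable (fg_near x Ux) (df x Ux).
by apply: IH (dfC v) => x Ux; exact: near_eq_derive (fg_near x Ux).
Qed.

Lemma C_on_cst n (V W : normedModType R) (U : set V) (c : W) : C_on n U (cst c : V -> W).
Proof.
elim: n c => [|n IH] c; first by move=> x _; exact: cst_continuous.
split=> [x _|v]; first exact: differentiable_cst.
rewrite (_ : (fun x => _) = cst 0); first exact: IH.
by apply/funext => x; exact: derive_cst.
Qed.

Lemma continuous_mulmxr m n (M : 'M[R]_(m, n)) :
  continuous (mulmxr M : 'rV[R]_m -> 'rV[R]_n).
Proof.
move=> x; apply: differentiable_continuous.
rewrite (_ : (mulmxr M : _ -> _) = \sum_i (fun y : 'rV[R]_m => y 0 i *: row i M)); last first.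
  by apply/funext => y; rewrite /= mulmx_sum_row fct_sumE.
apply: differentiable_sum => i; apply: differentiableZl.
exact: differentiable_coord.
Qed.

Lemma is_diff_mulmx m n (M : 'M[R]_(m, n)) (c x : 'rV[R]_m) :
  is_diff x (fun y : 'rV[R]_m => (y - c) *m M) (mulmxr M).
Proof.
have dM : is_diff x (mulmxr M : 'rV[R]_m -> 'rV[R]_n) (mulmxr M).
  apply: DiffDef; first by apply: linear_differentiable; exact: continuous_mulmxr.
  by apply: diff_lin; exact: continuous_mulmxr.
rewrite (_ : (fun y => _) = (mulmxr M : _ -> _) - cst (c *m M)); last first.
  by apply/funext => y; rewrite mulmxBl.
by apply: is_diff_eq; rewrite subr0.
Qed.

Lemma C_on_affine k m n (M : 'M[R]_(m, n)) (c : 'rV[R]_m)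
    (U : set 'rV[R]_m) :
  C_on k U (fun y : 'rV[R]_m => (y - c) *m M).
Proof.
case: k => [x _|k].
  by have dA := is_diff_mulmx M c x; apply: differentiable_continuous; exact: ex_diff.
split=> [x _|v].
  by have dA := is_diff_mulmx M c x; exact: ex_diff.
rewrite (_ : (fun x => _) = cst (v *m M)); first exact: C_on_cst.
apply/funext => x; have dA := is_diff_mulmx M c x.
by rewrite deriveE ?diff_val//; exact: ex_diff.
Qed.
End LocalSmoothness.

Section AffineMaps.
Variable R : realType.
Implicit Types (x y : 'rV[R]_2) (c p q : torus R) (M N : 'M[int]_2).

(** Since [M] is integral it preserves the lattice, so the choice of representative does not matter
    ([torus_affine_pi]). *)
Definition torus_affine c M p : torus R :=
  c + torus_pi (torus_repr p *m map_mx intr M).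

Lemma int_lattice_mulmx x M :
  x \in @int_lattice R -> x *m map_mx intr M \in @int_lattice R.
Proof.
move=> /forallP xZ; apply/forallP => j; rewrite !mxE rpred_sum// => i _.
by rewrite mxE rpredM// intr_int.
Qed.

Lemma torus_affine_pi c M x :
  torus_affine c M (torus_pi x) = c + torus_pi (x *m map_mx intr M).
Proof.
congr (_ + _); apply/eqP; rewrite -subr_eq0 -torus_piB -mulmxBl torus_pi_eq0.
by rewrite int_lattice_mulmx// -torus_pi_eq0 torus_piB torus_reprK subrr.
Qed.

Lemma torus_affine_comp c d M N p :
  torus_affine c M (torus_affine d N p) = torus_affine (torus_affine c M d) (N *m M) p.
Proof.
rewrite -[p]torus_reprK -[d]torus_reprK !torus_affine_pi -torus_piD.
by rewrite !torus_affine_pi mulmxDl torus_piD addrA -mulmxA map_mxM.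
Qed.

Lemma torus_affine1 c p : torus_affine c 1%:M p = c + p.
Proof. by rewrite /torus_affine map_mx1 mulmx1 torus_reprK. Qed.

Lemma torus_affineN1 c p : torus_affine c (-1)%:M p = c - p.
Proof.
by rewrite /torus_affine map_scalar_mx mul_mx_scalar scaleN1r torus_piN torus_reprK.
Qed.

Lemma torus_affine_cst c M : torus_affine c M 0 = c.
Proof. by rewrite -torus_pi0 torus_affine_pi mul0mx torus_pi0 addr0. Qed.

Lemma torus_affineD c d M p : torus_affine (c + d) M p = c + torus_affine d M p.
Proof. by rewrite /torus_affine addrA. Qed.

(** As long as the displacement [(y - x) M] stays below [1/2], it is its own centred representative,
    so the chart reads it off unchanged. *)
Lemma torus_affine_chart c M x :
  let U := [set y | `|(y - x) *m map_mx intr M| < 2^-1] in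
  [/\ open U, U x &
    forall y, U y -> (y - x) *m map_mx intr M =
      (chart ((torus_affine c M \o @torus_pi R) x) \o
        (torus_affine c M \o @torus_pi R)) y].
Proof.
move=> U; split; last 2 first.
- by rewrite /U/= subrr mul0mx normr0.
- move=> y Uy; rewrite /= chartE !torus_affine_pi opprD addrACA subrr add0r.
  by rewrite -torus_piB -mulmxBl torus_coord_lt_half.
pose A (y : 'rV[R]_2) : 'rV[R]_2 := (y - x) *m map_mx intr M.
have Ac : continuous A.
  move=> y; apply: differentiable_continuous.
  by have dA := is_diff_mulmx (map_mx intr M) x y; exact: ex_diff.
rewrite (_ : U = (fun y => `|A y|) @^-1` [set t | t < 2^-1])//.
apply: open_comp; last exact: open_lt.
by move=> y _; apply: continuous_comp; [exact: Ac|exact: norm_continuous].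
Qed.

Lemma torus_affine_smooth c M : torus_smooth (torus_affine c M \o @torus_pi R).
Proof.
move=> x; have [Uopen Ux UE] := torus_affine_chart c M x.
exists [set y | `|(y - x) *m map_mx intr M| < 2^-1]; split => // n.
by apply: eq_on_C_on UE _ => //; exact: C_on_affine.
Qed.

Lemma tangent_torus_affine c M p (v : 'rV[R]_2) :
  tangent_map (torus_affine c M) p v = v *m map_mx intr M.
Proof.
rewrite /tangent_map /torus_derive; set x := torus_repr p.
have [Uopen Ux UE] := torus_affine_chart c M x.
have dA := is_diff_mulmx (map_mx intr M : 'M[R]_2) x x.
rewrite -(@near_eq_derive _ _ _ (fun y => (y - x) *m map_mx intr M)).
  by rewrite deriveE ?diff_val//; exact: ex_diff.
by apply: filterS (open_nbhs_nbhs (conj Uopen Ux)).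
Qed.

(** Solving [c + p M = p'] for [p] gives [- c N + p' N]; the term [torus_affine 0 N c] is [c N]. *)
Lemma torus_affineK c M N : M *m N = 1%:M ->
  cancel (torus_affine c M) (torus_affine (- torus_affine 0 N c) N).
Proof.
move=> MN p; rewrite torus_affine_comp MN torus_affine1.
by rewrite -[- torus_affine 0 N c]addr0 torus_affineD addNr add0r.
Qed.

Lemma torus_affineVK c M N : M *m N = 1%:M ->
  cancel (torus_affine (- torus_affine 0 N c) N) (torus_affine c M).
Proof.
move=> MN p; rewrite torus_affine_comp (mulmx1C MN) torus_affine1.
suff -> : torus_affine c M (- torus_affine 0 N c) = 0 by rewrite add0r.
rewrite {2}/torus_affine add0r -torus_piN torus_affine_pi mulNmx -mulmxA.
by rewrite -map_mxM (mulmx1C MN) map_mx1 mulmx1 torus_piN torus_reprK subrr.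
Qed.

Definition affine_bijection c M N (MN : M *m N = 1%:M) : bijections (torus R) :=
  Bijection (torus_affineK c MN) (torus_affineVK c MN).

Lemma Diff_affine c M N (MN : M *m N = 1%:M) : Diff (affine_bijection c MN).
Proof. by split; exact: torus_affine_smooth. Qed.

Definition translation c : bijections (torus R) := affine_bijection c (mulmx1 1%:M).

Lemma translationE c p : translation c p = c + p.
Proof. exact: torus_affine1. Qed.

Lemma mulmxN1N1 : (-1)%:M *m (-1)%:M = 1%:M :> 'M[int]_2.
Proof. by rewrite -scalar_mxM mulrNN mulr1. Qed.

Definition torus_opp : bijections (torus R) := affine_bijection 0 mulmxN1N1.

Lemma translation_multiplicative : {morph translation : c d / c + d >-> (c * d)%g}.
Proof. by move=> c d; apply: bijections_eq => p; rewrite /= !torus_affine1 addrA. Qed.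

End AffineMaps.

(** * The symmetry group *)

Section SymmetryGroup.
Variables (R : realType) (psi : R -> torus R -> torus R) (a : 'rV[R]_2).
Hypothesis psi_a : forall p, generating_field psi p = a.
Hypothesis a_ind : Q_independent (a 0).
Implicit Types (x y : 'rV[R]_2) (p q : torus R) (f : bijections (torus R)).

Lemma eigen_matrixP (M : 'M[int]_2) (alpha : R) :
  a *m map_mx intr M = alpha *: a <->
  a 0 0 * (M 0 0)%:~R + a 0 1 * (M 1 0)%:~R = alpha * a 0 0 /\
  a 0 0 * (M 0 1)%:~R + a 0 1 * (M 1 1)%:~R = alpha * a 0 1.
Proof.
have E j : (a *m map_mx intr M) 0 j = a 0 0 * (M 0 j)%:~R + a 0 1 * (M 1 j)%:~R.
  by rewrite mxE sum_ord2 !mxE.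
rewrite -!E; split=> [->|[e0 e1]]; first by rewrite !mxE.
by apply/rowP; apply: ord2P; rewrite [RHS]mxE.
Qed.

(** Each coordinate of the eigenvector equation is an integer relation between the components of
    [a], so every entry of [M - k] vanishes. *)
Lemma eigen_int (M : 'M[int]_2) (k : int) :
  a *m map_mx intr M = k%:~R *: a -> M = k%:M.
Proof.
move=> /eigen_matrixP [e0 e1].
have [|M00 M10] := @Q_independent2_int _ _ (M 0 0 - k) (M 1 0) a_ind.
  by rewrite intrB; lra.
have [|M01 M11] := @Q_independent2_int _ _ (M 0 1) (M 1 1 - k) a_ind.
  by rewrite intrB; lra.
apply/matrixP; apply: ord2P; apply: ord2P; rewrite !mxE/= ?mulr1n ?mulr0n//.
- by apply/eqP; rewrite -subr_eq0 M00.
- by apply/eqP; rewrite -subr_eq0 M11.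
Qed.

Lemma speed_neq0 : a != 0.
Proof.
by have := Q_independent2_neq0 a_ind; apply: contraNneq => ->; rewrite mxE.
Qed.

(** The value picked by [get] is determined because [a] is nonzero. *)
Lemma multiplierE f alpha : scales_field psi f alpha -> multiplier psi f = alpha.
Proof.
move=> fa; have [_ /(_ 0) e1] : scales_field psi f (multiplier psi f) by exact: getI fa.
have [_ /(_ 0)] := fa; rewrite e1 !psi_a => /eqP.
by rewrite -subr_eq0 -scalerBl scaler_eq0 (negPf speed_neq0) orbF subr_eq0 => /eqP.
Qed.

Lemma symmetry_scales f : symmetry_group psi f -> scales_field psi f (multiplier psi f).
Proof. by move=> [_ [alpha fa]]; exact: getI fa. Qed.

Lemma affine_scales c M N (MN : M *m N = 1%:M) (alpha : R) : alpha != 0 ->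
  a *m map_mx intr M = alpha *: a -> scales_field psi (affine_bijection c MN) alpha.
Proof.
move=> alpha0 aM; split=> // p.
by rewrite /Defs.pushforward !psi_a tangent_torus_affine.
Qed.

Lemma affine_symmetry c M N (MN : M *m N = 1%:M) (alpha : R) : alpha != 0 ->
  a *m map_mx intr M = alpha *: a -> symmetry_group psi (affine_bijection c MN).
Proof.
by move=> alpha0 aM; split; [exact: Diff_affine|exists alpha; exact: affine_scales].
Qed.

Lemma translation_scales c : scales_field psi (translation c) 1.
Proof. by apply: affine_scales; rewrite ?oner_eq0// map_mx1 mulmx1 scale1r. Qed.

Lemma translation_symmetry c : symmetry_group psi (translation c).
Proof. by split; [exact: Diff_affine|exists 1; exact: translation_scales]. Qed.

Lemma torus_opp_scales : scales_field psi (torus_opp R) (-1).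
Proof.
apply: affine_scales; first by rewrite oppr_eq0 oner_eq0.
by rewrite map_scalar_mx mul_mx_scalar.
Qed.

Lemma torus_opp_symmetry : symmetry_group psi (torus_opp R).
Proof. by split; [exact: Diff_affine|exists (-1); exact: torus_opp_scales]. Qed.

Lemma symmetry_int_multiplier f (k : int) : Diff f -> scales_field psi f k%:~R ->
  forall p, f p = f 0 + torus_pi (k%:~R *: torus_repr p).
Proof.
move=> Df fk p; have [B [aB fB]] := symmetry_affine psi_a a_ind Df fk.
rewrite -{1}[p]torus_reprK fB (eigen_int aB).
by rewrite map_scalar_mx mul_mx_scalar.
Qed.

Lemma symmetry_multiplier1 f : Diff f -> scales_field psi f 1 ->
  f = translation (f 0).
Proof.
move=> Df f1; apply: bijections_eq => p.
by rewrite (symmetry_int_multiplier (k := 1) Df f1) translationE scale1r torus_reprK.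
Qed.

Lemma symmetry_multiplierN1 f : Diff f -> scales_field psi f (-1) ->
  f = (translation (f 0) * torus_opp R)%g.
Proof.
move=> Df f1; apply: bijections_eq => p.
rewrite (symmetry_int_multiplier (k := -1) Df f1) scaleN1r torus_piN torus_reprK.
by rewrite /= torus_affine1 torus_affineN1 add0r.
Qed.

Lemma multiplier_kernelP f :
  multiplier_kernel psi f <-> exists c, f = translation c.
Proof.
split=> [[Sf /= f1]|[c ->]].
  exists (f 0); apply: symmetry_multiplier1; first by case: Sf.
  by rewrite -f1; exact: symmetry_scales.
by split; [exact: translation_symmetry|exact/multiplierE/translation_scales].
Qed.

Lemma kernel_isomorphic_torus :
  isomorphic_to (Algebra.to_multiplicative (torus R)) (multiplier_kernel psi).
Proof.
pose phi : Algebra.to_multiplicative (torus R) -> bijections (torus R) := @translation R.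
pose phiM := isMultiplicative.Build _ _ phi (@translation_multiplicative R).
pose Phi : {multiplicative Algebra.to_multiplicative (torus R) -> bijections (torus R)} :=
  HB.pack phi phiM.
exists Phi; split.
- by move=> c _; apply/multiplier_kernelP; exists c.
- move=> c d _ _ /(congr1 (fun f : bijections (torus R) => f 0)).
  by rewrite /= !torus_affine_cst.
- by move=> f /multiplier_kernelP[c ->]; exists c.
Qed.

Lemma torus_opp_neq1 : torus_opp R <> 1%g.
Proof.
move=> e; have := multiplierE torus_opp_scales; rewrite e.
have -> : 1%g = translation 0 :> bijections (torus R).
  by apply: bijections_eq => p; rewrite translationE add0r.
by rewrite (multiplierE (translation_scales 0)); lra.
Qed.

Lemma torus_opp_involutive : (torus_opp R * torus_opp R = 1)%g.
Proof. by apply: bijections_eq => p; rewrite /= !torus_affineN1 !add0r opprK. Qed.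

Lemma opp_group_isomorphic_Z2 :
  isomorphic_to (Algebra.to_multiplicative 'Z_2) [set 1%g; torus_opp R].
Proof.
pose phi : Algebra.to_multiplicative 'Z_2 -> bijections (torus R) :=
  fun z => if z == 0 :> 'Z_2 then 1%g else torus_opp R.
have phi_morph : {morph phi : c d / (c * d)%g >-> (c * d)%g}.
  apply: ord2P; apply: ord2P; rewrite /phi/= ?mul1g ?mulg1//.
  by rewrite torus_opp_involutive.
pose phiM := isMultiplicative.Build _ _ phi phi_morph.
pose Phi : {multiplicative Algebra.to_multiplicative 'Z_2 -> bijections (torus R)} :=
  HB.pack phi phiM.
exists Phi; split.
- by move=> z _; rewrite /= /phi; case: ifP; [left|right].
- move=> z w _ _; move: z w; apply: ord2P; apply: ord2P => //=; rewrite /phi/=.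
  + by move=> /esym/torus_opp_neq1.
  + by move=> /torus_opp_neq1.
- by move=> f [->|->]; [exists 0|exists 1].
Qed.

(** The complement is generated by [p |-> - p]: a symmetry of multiplier 1 is a translation, and one
    of multiplier -1 is a translation after [torus_opp]. *)
Lemma semidirect_of_multiplier_group : multiplier_group psi = [set 1; -1] ->
  semidirect_of_torus_by psi (Algebra.to_multiplicative 'Z_2).
Proof.
move=> M1; exists [set 1%g; torus_opp R]; split; last 2 first.
- exact: kernel_isomorphic_torus.
- exact: opp_group_isomorphic_Z2.
have tr0 : translation 0 = 1%g :> bijections (torus R).
  by apply: bijections_eq => p; rewrite translationE add0r.
have trV c : translation (- c) = (translation c)^-1%g :> bijections (torus R).
  by apply: (mulgI (translation c)); rewrite mulgV -translation_multiplicative subrr.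
split.
- split; first by move=> f [].
  split; first by rewrite inE -tr0; apply/multiplier_kernelP; exists 0.
  move=> f g /set_mem/multiplier_kernelP[c ->] /set_mem/multiplier_kernelP[d ->].
  rewrite -trV -translation_multiplicative.
  by apply/mem_set/multiplier_kernelP; exists (c - d).
- split.
    move=> f [->|->]; last exact: torus_opp_symmetry.
    by rewrite -tr0; exact: translation_symmetry.
  have oppV : ((torus_opp R)^-1 = torus_opp R)%g.
    by apply: (mulgI (torus_opp R)); rewrite mulgV torus_opp_involutive.
  split; first by rewrite inE; left.
  move=> f g; rewrite !inE => -[->|->] [->|->]; rewrite ?invg1 ?mulg1 ?mul1g.
  + by left.
  + by right.
  + by right.
  + by rewrite mulgV; left.
- move=> s n Ss /multiplier_kernelP[c ->]; apply/multiplier_kernelP.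
  have /symmetry_scales sa := Ss; have [Ds _] := Ss.
  (* By [symmetry_translate], [s (c + s^-1 p) = s c + p - s 0]. *)
  exists (s c - s 0); apply: bijections_eq => p.
  rewrite translationE /= torus_affine1 (symmetry_translate psi_a a_ind _ _ Ds sa).
  by rewrite (bij_invK s p) addrAC.
- apply/seteqP; split=> f /=.
    move=> [/multiplier_kernelP[c ->] [//|e]].
    have := multiplierE (translation_scales c).
    by rewrite e (multiplierE torus_opp_scales) => /eqP; rewrite eqNr oner_eq0.
  by move=> ->; split; [rewrite -tr0; apply/multiplier_kernelP; exists 0|left].
- apply/seteqP; split=> f /=.
    move=> Sf; have /symmetry_scales fa := Sf; have [Df _] := Sf.
    have : multiplier_group psi (multiplier psi f) by exists f.
    rewrite M1 => -[e|e]; rewrite e in fa.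
      exists f; first by apply/multiplier_kernelP; exists (f 0); exact: symmetry_multiplier1.
      by exists 1%g; [left|rewrite mulg1].
    exists (translation (f 0)); first by apply/multiplier_kernelP; exists (f 0).
    by exists (torus_opp R); [right|rewrite -symmetry_multiplierN1].
  move=> [n /multiplier_kernelP[c ->]] [h [->|->]] <-.
    by rewrite mulg1; exact: translation_symmetry.
  rewrite (_ : (_ * _)%g = affine_bijection c mulmxN1N1).
    apply: affine_symmetry (-1) _ _; first by rewrite oppr_eq0 oner_eq0.
    by rewrite map_scalar_mx mul_mx_scalar.
  by apply: bijections_eq => p; rewrite /= torus_affine1 !torus_affineN1 add0r.
Qed.
End SymmetryGroup.

(** * Quadratic fields *)

Section QuadraticFields.
Variable R : realType.

(** With [t = b 1], a root of [t^2 = r + s t], the span is [Q + Q t]. Division uses the conjugate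
    [u' + s v' - v' t] of [u' + v' t], obtained from the other root [s - t]. *)
Lemma quadratic_span_field (b : 'I_2 -> R) (r s : rat) :
  Q_independent b -> b 0 = 1 -> b 1 ^+ 2 = ratr r + ratr s * b 1 ->
  real_quadratic_field [set x | exists c : 'I_2 -> rat, x = \sum_i ratr (c i) * b i].
Proof.
move=> b_ind b0 b1; set F := [set x | _]; set t := b 1 in b1.
have FE x : F x <-> exists u v : rat, x = ratr u + ratr v * t.
  split=> [[c ->]|[u [v ->]]].
    by exists (c 0), (c 1); rewrite sum_ord2 b0 mulr1.
  by exists (fun i => if i == 0 then u else v); rewrite sum_ord2 b0 mulr1.
split; last by exists b; split.
have inF x : (x \in [in F]) = (x \in F) by [].
split.
- by rewrite inF inE; apply/FE; exists 1, 0; rewrite rmorph1 rmorph0 mul0r addr0.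
- move=> x y; rewrite !inF !inE => /FE[u [v ->]] /FE[u' [v' ->]]; apply/FE.
  by exists (u - u'), (v - v'); rewrite !rmorphB /=; ring.
- move=> x y; rewrite !inF !inE => /FE[u [v ->]] /FE[u' [v' ->]]; apply/FE.
  (* Closure under division includes the divisor 0, for which the quotient is 0. *)
  have [y0|y_neq0] := eqVneq (ratr u' + ratr v' * t) 0.
    by exists 0, 0; rewrite y0 invr0 mulr0 !rmorph0 mul0r addr0.
  (* The norm of [u' + v' t], its product with the conjugate. *)
  pose n : rat := u' ^+ 2 + s * u' * v' - r * v' ^+ 2.
  have nE : ratr n = (ratr u' + ratr v' * t) * (ratr u' + ratr s * ratr v' - ratr v' * t).
    rewrite /n !(rmorphB, rmorphD, rmorphM, rmorphXn)/=.
    have -> : (ratr u' + ratr v' * t) * (ratr u' + ratr s * ratr v' - ratr v' * t) =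
       ratr u' ^+ 2 + ratr s * ratr u' * ratr v' + ratr v' ^+ 2 * (ratr s * t) -
       ratr v' ^+ 2 * t ^+ 2 by ring.
    by rewrite b1; ring.
  have n_neq0 : ratr n != 0 :> R.
    rewrite nE mulf_neq0//; apply/eqP => conj0.
    have [|c0 c1] := (Q_independent2 b).1 b_ind (u' + s * v') (- v').
      by rewrite b0 -/t rmorphD rmorphN rmorphM /= mulr1 mulNr.
    move: c0 c1 y_neq0 => + /eqP; rewrite oppr_eq0 => + /eqP v0.
    by rewrite v0 mulr0 addr0 => ->; rewrite rmorph0 mul0r addr0 eqxx.
  exists ((u * u' + s * u * v' - r * v * v') / n), ((v * u' - u * v') / n).
  apply: (mulIf y_neq0); rewrite divfK//; apply: (mulIf n_neq0).
  rewrite [LHS]mulrC {1}nE -[LHS]mulrA [LHS]mulrC [RHS]mulrAC; congr (_ * _).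
  rewrite [in RHS]rmorphM [ratr (_ / n)]rmorphM fmorphV/= [ratr _ / _ * t]mulrAC.
  rewrite -mulrDl divfK// !(rmorphB, rmorphD, rmorphM) /=.
  have -> : (ratr u' + ratr s * ratr v' - ratr v' * t) * (ratr u + ratr v * t) =
     ratr u * ratr u' + ratr s * ratr u * ratr v' + ratr s * ratr v * ratr v' * t +
     (ratr v * ratr u' - ratr u * ratr v') * t - ratr v * ratr v' * t ^+ 2 by ring.
  by rewrite b1; ring.
Qed.

(** The element [b 1 ^+ 2 / b 0] of the field is a rational combination of [b 0] and [b 1];
    multiplying by [b 0] and clearing denominators gives the relation. *)
Lemma quadratic_field_relation (F : set R) (b : 'I_2 -> R) :
  real_quadratic_field F -> Q_basis b F ->
  exists m p q : int, m != 0 /\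
    m%:~R * b 1 ^+ 2 = p%:~R * b 0 ^+ 2 + q%:~R * b 0 * b 1.
Proof.
move=> [Ffield _] [b_ind FE].
have b0 := Q_independent2_neq0 b_ind.
have bF i : b i \in [in F].
  rewrite -[_ \in _]/(_ \in F) inE FE; exists (fun j => (j == i)%:R).
  by rewrite (bigD1 i)//= eqxx rmorph1 mul1r big1 ?addr0//
    => j /negPf ->; rewrite rmorph0 mul0r.
have [F1 _ Fdiv] := Ffield.
have FM x y : x \in [in F] -> y \in [in F] -> x * y \in [in F].
  by move=> xF yF; rewrite -[y]invrK -[y^-1]mul1r Fdiv// Fdiv.
have : b 1 * b 1 / b 0 \in [in F] by rewrite Fdiv// FM.
rewrite -[_ \in _]/(_ \in F) inE FE => -[c]; rewrite sum_ord2 => e.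
exists (denq (c 0) * denq (c 1)), (numq (c 0) * denq (c 1)), (numq (c 1) * denq (c 0)).
split; first by rewrite mulf_neq0 ?denq_eq0.
have d0 : (denq (c 0))%:~R != 0 :> R by rewrite intr_eq0 denq_eq0.
have d1 : (denq (c 1))%:~R != 0 :> R by rewrite intr_eq0 denq_eq0.
have -> : b 1 ^+ 2 = b 0 * (b 1 * b 1 / b 0) by field.
by rewrite e /ratr !intrM; field; rewrite d0 d1.
Qed.
End QuadraticFields.

(** * Integer matrices with eigenvector [a] *)

Section Multipliers.
Variable R : realType.

(** The slope [a1 / a0] is a root of [m T^2 = q T + p], and [d] is a square root of its
    discriminant. A Pell solution gives [alpha = x + y d], and [M] is multiplication by [alpha]
    written on [a0], [a1]. *)
Lemma pell_matrix (a : 'rV[R]_2) (m p q : int) : Q_independent (a 0) -> m != 0 ->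
  m%:~R * a 0 1 ^+ 2 = p%:~R * a 0 0 ^+ 2 + q%:~R * a 0 0 * a 0 1 ->
  exists (M N : 'M[int]_2) (alpha : R), [/\ M *m N = 1%:M,
    a *m map_mx intr M = alpha *: a & forall k : int, alpha != k%:~R].
Proof.
move=> a_ind m_neq0 rel; have a0_neq0 := Q_independent2_neq0 a_ind.
set a0 := a 0 0 in rel a0_neq0 *; set a1 := a 0 1 in rel *.
pose d := 2 * m%:~R * (a1 / a0) - q%:~R.
have [||x [y [y_neq0 xy]]] := @pell R (q ^+ 2 + 4 * m * p) d.
- have -> : d ^+ 2 = 4 * m%:~R * (m%:~R * a1 ^+ 2) / a0 ^+ 2
      - 4 * m%:~R * q%:~R * a1 / a0 + q%:~R ^+ 2 by rewrite /d; field.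
  by rewrite rel intrD !intrM; field.
- move=> u v uv; have [|_ /eqP] := @Q_independent2_int _ _ (u + v * q) (- (2 * m * v)) a_ind.
    rewrite -/a0 -/a1 intrD intrN !intrM uv /d; field; exact: a0_neq0.
  by rewrite oppr_eq0 !mulf_eq0 (negPf m_neq0) /= => /eqP.
exists (\matrix_(i, j) if i == 0 then if j == 0 then x - y * q else 2 * y * p
                       else if j == 0 then 2 * y * m else x + y * q).
(* The adjugate of the first matrix, whose determinant is [x^2 - D y^2 = 1] with [D] the
   discriminant. *)
exists (\matrix_(i, j) if i == 0 then if j == 0 then x + y * q else - (2 * y * p)
                       else if j == 0 then - (2 * y * m) else x - y * q).
exists (x%:~R - y%:~R * q%:~R + 2 * y%:~R * m%:~R * (a1 / a0)); split.
- apply/matrixP; apply: ord2P; apply: ord2P; rewrite !mxE sum_ord2 !mxE /=.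
  + by rewrite -[RHS]xy; ring.
  + by rewrite mulr0n; ring.
  + by rewrite mulr0n; ring.
  + by rewrite -[RHS]xy; ring.
- apply/eigen_matrixP; rewrite !mxE /= -/a0 -/a1 !(intrM, intrB, intrD); split.
    by field.
  have -> : (x%:~R - y%:~R * q%:~R + 2 * y%:~R * m%:~R * (a1 / a0)) * a1 =
     x%:~R * a1 - y%:~R * q%:~R * a1 + 2 * y%:~R * (m%:~R * a1 ^+ 2) / a0 by field.
  by rewrite rel; field.
- move=> k; apply/eqP => e.
  have [|_ /eqP] := @Q_independent2_int _ _ (x - y * q - k) (2 * y * m) a_ind.
    rewrite -/a0 -/a1 !intrB -e !intrM; field; exact: a0_neq0.
  by rewrite !mulf_eq0 (negPf m_neq0) (negPf y_neq0).
Qed.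

(** Eliminating [alpha] from the two eigenvector equations gives a quadratic equation for [a1 / a0]
    with leading coefficient [B 1 0]. Scaling by [1 / a0] turns the basis into [1, a1 / a0]. *)
Lemma eigen_quadratic_field (a : 'rV[R]_2) (B : 'M[int]_2) (alpha : R) :
  Q_independent (a 0) -> a *m map_mx intr B = alpha *: a -> B 1 0 != 0 ->
  exists F : set R, real_quadratic_field F /\ Q_basis (fun i => (a 0 0)^-1 * a 0 i) F.
Proof.
move=> a_ind /eigen_matrixP [e0 e1] B10; have a0_neq0 := Q_independent2_neq0 a_ind.
pose b (i : 'I_2) := (a 0 0)^-1 * a 0 i.
pose F := [set x | exists c : 'I_2 -> rat, x = \sum_i ratr (c i) * b i].
have b_ind : Q_independent b.
  apply/Q_independent2 => u v uv; apply: ((Q_independent2 _).1 a_ind).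
  apply: (mulfI (_ : (a 0 0)^-1 != 0)); first by rewrite invr_eq0.
  by rewrite mulr0 -[RHS]uv /b; ring.
exists F; split => //.
apply: (@quadratic_span_field _ b ((B 0 1)%:~R / (B 1 0)%:~R)
  (((B 1 1)%:~R - (B 0 0)%:~R) / (B 1 0)%:~R)) => //.
  by rewrite /b mulVf.
have B10R : (B 1 0)%:~R != 0 :> R by rewrite intr_eq0.
rewrite !rmorphM !fmorphV rmorphB /= !ratr_int /b.
apply: (mulfI B10R); apply: (mulfI a0_neq0); apply: (mulfI a0_neq0).
set A0 := a 0 0 in e0 e1 a0_neq0 *; set A1 := a 0 1 in e0 e1 *.
have E : A0 * (A0 * (B 0 1)%:~R + A1 * (B 1 1)%:~R) =
    A1 * (A0 * (B 0 0)%:~R + A1 * (B 1 0)%:~R).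
  by rewrite e0 e1; ring.
transitivity (A1 * (A0 * (B 0 0)%:~R + A1 * (B 1 0)%:~R) - A0 * A1 * (B 0 0)%:~R).
  by field.
by rewrite -E; field; rewrite a0_neq0.
Qed.

Lemma torus_line_speed_inj (a : 'rV[R]_2) (u v : R) : a != 0 ->
  (forall t, torus_pi ((t * u) *: a) = torus_pi ((t * v) *: a)) -> u = v.
Proof.
move=> a_neq0 uv; apply/eqP; rewrite -subr_eq0.
suff : (u - v) *: a = 0.
  by move/eqP; rewrite scaler_eq0 (negPf a_neq0) orbF.
apply: torus_pi_line_inj => t.
by rewrite scalerA mulrBr scalerBl torus_piB uv subrr.
Qed.
End Multipliers.

Theorem corollary4p6 (R : realType) (psi : R -> torus R -> torus R)
    (psi_qp : quasiperiodic psi) :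
  [<-> transcendental psi;
       multiplier_group psi = [set 1; -1];
       semidirect_of_torus_by psi (Algebra.to_multiplicative 'Z_2)].
Proof.
have [_ [a [psi_a a_ind]]] := psi_qp.
tfae.
- move=> [_ psi_tr]; apply/seteqP; split=> [alpha [f Sf <-{alpha}]|alpha].
    have fa := symmetry_scales Sf; have [Df _] := Sf.
    have [B [aB fB]] := symmetry_affine psi_a a_ind Df fa.
    (* A nonzero entry would make the flow algebraic; if it is zero, the first eigenvector equation
       identifies the multiplier with [B 0 0]. *)
    have [B10|B10] := eqVneq (B 1 0) 0; last first.
      have [F [Fquad Fbasis]] := eigen_quadratic_field a_ind aB B10.
      exfalso; apply: (psi_tr F Fquad); split => //.
      exists a, (a 0 0)^-1; split => //.
      by rewrite invr_eq0 Q_independent2_neq0.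
    have [k ek] : exists k : int, multiplier psi f = k%:~R.
      exists (B 0 0); have /eigen_matrixP [+ _] := aB.
      rewrite B10 mulr0 addr0 mulrC => /mulIf -> //; exact: Q_independent2_neq0.
    have k_neq0 : k%:~R != 0 :> R by rewrite -ek; case: fa.
    rewrite ek in fa *.
    (* The linear part of [f] is multiplication by [k], so [x / k] has the same image as 0.
       Injectivity makes [1 / k] an integer, hence [k] is 1 or -1. *)
    pose x : 'rV[R]_2 := delta_mx 0 0.
    have : torus_pi (k%:~R^-1 *: x) == 0.
      rewrite -(inj_eq (can_inj (bij_funK f))).
      rewrite ek in aB; rewrite fB (eigen_int a_ind aB) map_scalar_mx.
      rewrite mul_mx_scalar scalerA divff// scale1r.
      rewrite -[X in _ == X]addr0 (inj_eq (addrI _)) torus_pi_eq0.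
      by apply/forallP => j; rewrite !mxE; case: (_ && _); rewrite ?rpred0 ?rpred1.
    rewrite torus_pi_eq0 => /forallP /(_ 0); rewrite !mxE eqxx mulr1 => /intrP [l el].
    have kl : k * l = 1 by apply/eqP; rewrite -(eqr_int R) intrM -el divff.
    have /eqP : (`|k| * `|l|)%N = 1%N by rewrite -abszM kl.
    rewrite muln_eq1 => /andP[/eqP k1 _].
    have [->|->] : k = 1 \/ k = -1 by move: k1; clear; lia.
      by left.
    by right.
  move=> [->|->].
    exists (translation 0); first exact: translation_symmetry.
    by apply: (multiplierE psi_a a_ind); exact: translation_scales.
  exists (torus_opp R); first exact: torus_opp_symmetry.
  by apply: (multiplierE psi_a a_ind); exact: torus_opp_scales.
- exact: semidirect_of_multiplier_group.
- move=> [H [[_ [HS _] _ _ SNH] _ [phi phi_bij]]]; split=> // F Fquad.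
  move=> [_ [a' [theta [psi_a' theta_neq0 Fbasis]]]].
  have ea' : a' = a by rewrite -(psi_a' 0) psi_a.
  rewrite {a' psi_a'}ea' in Fbasis.
  have [m [p [q [m_neq0 rel]]]] := quadratic_field_relation Fquad Fbasis.
  have [|M [N [alpha [MN aM alpha_int]]]] := @pell_matrix R a m p q a_ind m_neq0.
    (* The relation is homogeneous of degree two, so it passes from [theta * a] to [a]. *)
    apply: (mulfI (expf_neq0 2 theta_neq0)).
    rewrite [LHS](_ : _ = m%:~R * (theta * a 0 1) ^+ 2); last by ring.
    by rewrite rel; ring.
  have alpha_neq0 : alpha != 0 := alpha_int 0.
  have fa := affine_scales psi_a 0 MN alpha_neq0 aM.
  have := affine_symmetry psi_a 0 MN alpha_neq0 aM.
  set f := affine_bijection 0 MN in fa *.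
  move=> Sf; have [Df _] := Sf; move: (Sf).
  rewrite SNH => -[n /(multiplier_kernelP psi_a a_ind) [c ->] [h Hh fE]].
  have [Dh _] := HS _ Hh; have hg := symmetry_scales (HS _ Hh).
  set gamma := multiplier psi h in hg.
  (* [h] corresponds to an element of a group of order two, whose square is trivial. *)
  have hh t : h (h t) = t.
    have [z _ <-] := set_bij_surj phi_bij Hh.
    have z2 : (z * z)%g = 1%g by move: z; apply: ord2P; apply/val_inj.
    have : (phi z * phi z = 1)%g by rewrite -gmulfM z2;
      apply: (mulgI (phi 1%g)); rewrite -gmulfM !mulg1.
    by move/(congr1 (fun g : bijections (torus R) => g t)).
  have a_neq0 := speed_neq0 a_ind.
  (* [f] is [h] followed by a translation, which does not change the speed along orbits. *)
  have gamma_alpha : alpha = gamma.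
    apply: (torus_line_speed_inj a_neq0) => t.
    have := symmetry_flow psi_a 0 t Df fa; rewrite -fE.
    rewrite [LHS]translationE (symmetry_flow psi_a 0 t Dh hg).
    rewrite [X in _ = X + _]translationE addrA => /addrI ->.
    by [].
  have gamma2 : gamma ^+ 2 = 1.
    apply: (torus_line_speed_inj a_neq0) => t.
    have := hh (0 + torus_pi (t *: a)).
    rewrite !(symmetry_flow psi_a _ _ Dh hg) hh => /addrI.
    by rewrite -mulrA mulr1.
  (* Square 1 would make [alpha] one of the integers 1 and -1, which [alpha_int] excludes. *)
  move/eqP: gamma2; rewrite -gamma_alpha sqrf_eq1.
  by rewrite (negPf (alpha_int 1)) (negPf (alpha_int (-1))).
Qed.
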